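(* Consider the Kullback-Leibler-Quadratic (KLQ) program $$J^\star(\nu_0^0)=\min_{\nu,\gamma}\Big[\sum_{k=1}^K \mathcal D(\nu_k,\nu_k^0)+\frac{\kappa}{2}\sum_{k=1}^K\gamma_k^2\Big]$$ subject to, for $1\le k\le K$, $$\text{(a)}\ \ \gamma_k=\langle\nu_k,\mathcal Y\rangle-r_k,\qquad \text{(b)}\ \ \sum_{u'}\nu_k(s',u')=\sum_{s,u}\nu_{k-1}(s,u)\,T_{k-1}((s,u),s')\quad (s'\in\mathsf S),$$ with $\nu_0=\nu_0^0$. An optimizer $\{\phi_k^\star:1\le k\le K\}$ (the sequence of randomized policies associated with optimal marginals) exists, is unique, and is of the form $$\phi_k^\star(u\mid s)=\phi_k^0(u\mid s)\exp\Big(\sum_{s'}T_k((s,u),s')\,g^\star_{k+1}(s')+\lambda_k^\star\,\mathcal Y(s,u)-g_k^\star(s)\Big),$$ where $$g_k^\star(s)=\log\Big(\sum_u\phi_k^0(u\mid s)\exp\Big(\sum_{s'}T_k((s,u),s')\,g^\star_{k+1}(s')+\lambda_k^\star\,\mathcal Y(s,u)\Big)\Big),\qquad 1\le k\le K,$$ $g^\star_{K+1}\equiv0$, and $\{\lambda_k^\star:1\le k\le K\}\subset\mathbb R$ and $\{g_k^\star(s): s\in\mathsf S,\,1\le k\le K\}$ are the Lagrange multipliers for the constraints (a) and (b), respectively.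
   Context: $\mathsf S$ and $\mathsf U$ are finite sets and $\mathsf X=\mathsf S\times\mathsf U$, with elements $x=(s,u)$. For a finite set $E$, $\mathcal S(E)$ is the set of probability mass functions (pmfs) on $E$. Fix an integer $K\ge1$, a constant $\kappa>0$, a function $\mathcal Y:\mathsf X\to\mathbb R$, real numbers $r_1,\dots,r_K$ (reference signal), controlled transition matrices $T_k$ (for each $k$ and $x\in\mathsf X$, $T_k(x,\cdot)\in\mathcal S(\mathsf S)$), and an initial pmf $\nu_0^0\in\mathcal S(\mathsf X)$. A randomized policy at time $k$ is a map $\phi_k$ from $\mathsf S$ to $\mathcal S(\mathsf U)$, written $\phi_k(u\mid s)$. Nominal policies $\phi_1^0,\dots,\phi_K^0$ are given; $\nu_k^0$ denotes the marginal at time $k$ under the nominal policies. The notation $\langle\nu,\mathcal Y\rangle=\sum_x\nu(x)\mathcal Y(x)$ is used. The optimization is over $\nu_k\in\mathcal S(\mathsf X)$ and $\gamma_k\in\mathbb R$, $1\le k\le K$. Given $\nu_k$, $\phi_k$ denotes the conditional pmf $\nu_k(s,u)=\phi_k(u\mid s)\sum_{u'}\nu_k(s,u')$, and the relative entropy rate is $$\mathcal D(\nu_k,\nu_k^0)=\sum_{s,u}\nu_k(s,u)\log\Big(\frac{\phi_k(u\mid s)}{\phi_k^0(u\mid s)}\Big),$$ with the usual conventions ($0\log 0=0$, value $+\infty$ if absolute continuity fails). The Lagrange multipliers $\lambda\in\mathbb R^K$ and $g=(g_1,\dots,g_K)$, $g_k:\mathsf S\to\mathbb R$, refer to the Lagrangian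 $$\mathcal L(\nu,\gamma,\lambda,g)=\sum_{k=1}^K\mathcal D(\nu_k,\nu_k^0)+\frac{\kappa}{2}\sum_{k=1}^K\gamma_k^2+\sum_{k=1}^K\lambda_k\big(\gamma_k+r_k-\langle\nu_k,\mathcal Y\rangle\big)+\sum_{k=1}^K\sum_{s'}\Big(\sum_{u'}\nu_k(s',u')-\sum_{s,u}\nu_{k-1}(s,u)T_{k-1}((s,u),s')\Big)g_k(s');$$ multipliers are maximizers $(\lambda^\star,g^\star)$ of the dual function $\varphi^\star(\lambda,g)=\min_{\nu,\gamma}\mathcal L(\nu,\gamma,\lambda,g)$, with $\nu_0=\nu_0^0$ fixed.
   Formalization: Uniqueness of the policies is asserted only at states of positive optimal marginal mass, since at zero-mass states the conditional pmf is arbitrary; the multipliers are those dual maximizers that satisfy the displayed recursion for g*, since dual maximizers are not unique. *)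

(* Defs.v *)
From mathcomp Require Import all_boot all_order all_algebra.
From mathcomp Require Import all_classical all_reals all_analysis.
Set Implicit Arguments.
Unset Strict Implicit.
Unset Printing Implicit Defensive.
Import Order.TTheory GRing.Theory Num.Theory.
Local Open Scope classical_set_scope.
Local Open Scope ring_scope.

Definition is_pmf (R : realType) (E : finType) (p : E -> R) : Prop :=
  (forall x, 0 <= p x) /\ \sum_x p x = 1.

Section KLQ.
Variables (R : realType) (S U : finType).

(* A randomized policy is a kernel [phi s u], read phi(u | s). *)
Definition is_policy (phi : S -> U -> R) : Prop := forall s, is_pmf (phi s).

Definition state_marginal (nu : S * U -> R) (s : S) : R := \sum_u nu (s, u).

Definition pairing (nu Y : S * U -> R) : R := \sum_x nu x * Y x.

(* phi is a version of the conditional pmf of u given s under nu; it is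
   determined by nu exactly at the states s of positive marginal mass. *)
Definition conditional_policy (nu : S * U -> R) (phi : S -> U -> R) : Prop :=
  is_policy phi /\ forall s u, nu (s, u) = phi s u * state_marginal nu s.

(* The relative entropy rate D(nu, nu0) depends on nu0 only through the nominal
   policy phi0.  When nu x != 0, the conditional probability phi(u | s) is
   nu (s, u) / state_marginal nu s, with a positive denominator if nu is a
   pmf. *)
Definition rel_entropy (nu : S * U -> R) (phi0 : S -> U -> R) : \bar R :=
  (\sum_(x : S * U)
    if nu x == 0%R then 0
    else if phi0 x.1 x.2 == 0%R then +oo
    else (nu x * ln ((nu x / state_marginal nu x.1) / phi0 x.1 x.2))%:E)%E.

(* Sequences are indexed by time; only the times 1, ..., K are variables, and
   the value at time 0 of a sequence of marginals is the given initial pmf. *)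
Variables (K : nat) (kappa : R) (Y : S * U -> R) (r : nat -> R).
Variables (T : nat -> S * U -> S -> R) (phi0 : nat -> S -> U -> R).
Variable nu00 : S * U -> R.

Definition klq_cost (nu : nat -> S * U -> R) (gamma : nat -> R) : \bar R :=
  (\sum_(1 <= k < K.+1) rel_entropy (nu k) (phi0 k)
   + (kappa / 2 * \sum_(1 <= k < K.+1) gamma k ^+ 2)%R%:E)%E.

Definition marginals (nu : nat -> S * U -> R) : Prop :=
  nu 0%N = nu00 /\ forall k, (1 <= k <= K)%N -> is_pmf (nu k).

Definition klq_feasible (nu : nat -> S * U -> R) (gamma : nat -> R) : Prop :=
  marginals nu /\ forall k, (1 <= k <= K)%N ->
    gamma k = pairing (nu k) Y - r k /\
    forall s', state_marginal (nu k) s' =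
               \sum_(x : S * U) nu k.-1 x * T k.-1 x s'.

Definition klq_optimal (nu : nat -> S * U -> R) (gamma : nat -> R) : Prop :=
  klq_feasible nu gamma /\ forall nu' gamma',
    klq_feasible nu' gamma' -> (klq_cost nu gamma <= klq_cost nu' gamma')%E.

Definition lagrangian (nu : nat -> S * U -> R) (gamma : nat -> R)
    (lambda : nat -> R) (g : nat -> S -> R) : \bar R :=
  (klq_cost nu gamma
   + (\sum_(1 <= k < K.+1) lambda k * (gamma k + r k - pairing (nu k) Y)
      + \sum_(1 <= k < K.+1) \sum_(s' : S)
          (state_marginal (nu k) s' - \sum_(x : S * U) nu k.-1 x * T k.-1 x s')
            * g k s')%R%:E)%E.

(* The infimum is attained: the Lagrangian is lower semicontinuous in nu, over a
   compact set, and quadratic with positive leading coefficient in gamma. *)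
Definition dual_function (lambda : nat -> R) (g : nat -> S -> R) : \bar R :=
  ereal_inf [set y | exists nu gamma,
    marginals nu /\ y = lagrangian nu gamma lambda g].

Definition lagrange_multipliers (lambda : nat -> R) (g : nat -> S -> R) : Prop :=
  forall lambda' g', (dual_function lambda' g' <= dual_function lambda g)%E.

Definition exponent (lambda : nat -> R) (g : nat -> S -> R)
    (k : nat) (s : S) (u : U) : R :=
  \sum_(s' : S) T k (s, u) s' * g k.+1 s' + lambda k * Y (s, u).

(* Maximizers of the dual function are not unique (adding a constant to g k
   leaves it unchanged); this recursion selects the representative. *)
Definition log_partition_recursion (lambda : nat -> R) (g : nat -> S -> R)
    : Prop :=
  (forall s, g K.+1 s = 0) /\
  forall k s, (1 <= k <= K)%N ->
    g k s = ln (\sum_(u : U) phi0 k s u * expR (exponent lambda g k s u)).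

End KLQ.

(* Main.v *)
Require Import Defs.
From mathcomp Require Import all_boot all_order all_algebra.
From mathcomp Require Import all_classical all_reals all_analysis.
From mathcomp Require Import ring lra.
Set Implicit Arguments.
Unset Strict Implicit.
Unset Printing Implicit Defensive.
Import Order.TTheory GRing.Theory Num.Theory numFieldNormedType.Exports.
Local Open Scope ring_scope.

(** The program is convex, and its Lagrangian can be completed exactly.  Given
    [lam] and [g] with [g K.+1 = 0], let [gibbs_policy lam g] be the nominal
    policy tilted by [expR (exponent - g)].  A telescoping sum over time
    ([klq_cost_decomposition], [lagrangian_decomposition]) turns the Lagrangian
    into

      sum of D(nu k, gibbs_policy k) + dual_value lam g
        + kappa/2 * sum of (gamma k + lam k / kappa)^2.

    If moreover [g] solves the log-partition recursion, the tilted policies are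
    honest policies, so that each relative entropy is nonnegative and vanishes
    exactly when [nu k] disintegrates along that policy ([rel_entropy_ge0],
    [rel_entropy_eq0]).  The minimum of the Lagrangian is then
    [dual_value lam g], attained when [nu] is the flow of the tilted policies
    and [gamma = - lam / kappa].

    The recursion determines [g] from [lam] backwards in time ([value_fn]), and
    this leaves a function [dual_obj] of [lam] alone.  The flow generated by
    [lam] obeys the dynamics, hence its Lagrangian at any other pair
    [(lam', g')] does not involve [g']; evaluating it yields
    [dual_le_quadratic], a strictly concave quadratic upper bound in [lam'] for
    the dual function at [(lam', g')], tangent to [dual_obj] at [lam].  Its
    linear coefficient [dual_grad lam k] is the residual
    [r k - lam k / kappa - <nu k, Y>] of the tracking constraint.  So [dual_obj]
    is coercive and attains its maximum, where the residual vanishes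
    ([strongly_concave_critical]; the tangent bound replaces the derivative of
    the log-partition functions).

    At such a [lam] the flow with [gamma = - lam / kappa] is feasible and its
    cost equals the dual value.  Weak duality makes both sides optimal; the
    completed form forces every other optimum to have zero relative entropies
    and zero squares, hence to be the same flow; and the quadratic bound forces
    every maximizer of the dual function to have the same [lam], whence the same
    [g] as soon as it satisfies the recursion.  The multipliers being unique,
    the formula holds at all states, including those of zero mass. *)

(** * Relative entropy *)

(** This is [1 - w < expR (- w)] for [w != 0], taken at [w = ln (a / b)] and
    multiplied by [a]. *)
Lemma xlnx_tangent_le (R : realType) (a b : R) : 0 < a -> 0 < b ->
  a - b <= a * ln (a / b) ?= iff (a == b).
Proof.
move=> a0 b0; set w := ln (a / b).
have ab0 : 0 < a / b by rewrite divr_gt0.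
have -> : b = a * expR (- w).
  by rewrite expRN lnK ?posrE// invf_div mulrC divfK ?gt_eqF.
rewrite -[X in X - _]mulr1 -mulrBr; apply/leifP.
have [->|w0] := eqVneq w 0; first by rewrite oppr0 expR0 subrr !mulr0 mulr1 eqxx.
have h : 1 - w < expR (- w) by rewrite expR_gt1Dx ?oppr_eq0.
rewrite ifF; first by rewrite ltr_pM2l // ltrBlDl -ltrBlDr.
apply/negbTE; rewrite -{1}[a]mulr1 -subr_eq0 -mulrBr mulf_eq0 gt_eqF//= subr_eq0.
by rewrite -expR0 (inj_eq (@expR_inj R)) eq_sym oppr_eq0.
Qed.

Lemma sume_eq0_ge0 (R : realType) (I : finType) (F : I -> \bar R) :
  (forall i, 0 <= F i)%E -> (\sum_i F i = 0)%E -> forall i, F i = 0%E.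
Proof.
move=> F0 sF i; apply/eqP; rewrite eq_le F0 andbT -sF (bigD1 i)//=.
by apply: leeDl; exact: sume_ge0.
Qed.

Section RelativeEntropy.
Variables (R : realType) (S U : finType).
Implicit Types (nu : S * U -> R) (phi : S -> U -> R).

Lemma sum_state_marginal nu : \sum_s state_marginal nu s = \sum_x nu x.
Proof.
by rewrite pair_big /=; apply: eq_bigr => -[].
Qed.

Lemma state_marginal_ge0 nu s : (forall x, 0 <= nu x) -> 0 <= state_marginal nu s.
Proof. by move=> nu0; apply: sumr_ge0. Qed.

Lemma state_marginal_gt0 nu x :
  (forall x, 0 <= nu x) -> nu x != 0 -> 0 < state_marginal nu x.1.
Proof.
case: x => s u nu0 nux; rewrite /state_marginal (bigD1 u)//=.
by rewrite ltr_pwDl ?sumr_ge0// lt_neqAle eq_sym nux nu0.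
Qed.

Lemma sum_pairing_state nu (h : S -> R) :
  \sum_x nu x * h x.1 = \sum_s state_marginal nu s * h s.
Proof.
rewrite [RHS](eq_bigr (fun s => \sum_u nu (s, u) * h s)); last first.
  by move=> s _; rewrite /state_marginal mulr_suml.
by rewrite pair_big /=; apply: eq_bigr => -[].
Qed.

Definition entropy_term nu phi (x : S * U) : \bar R :=
  if nu x == 0 then 0%E
  else if phi x.1 x.2 == 0 then +oo%E
  else (nu x * ln ((nu x / state_marginal nu x.1) / phi x.1 x.2))%:E.

(** The linear correction sums to zero over [S * U] when [phi] is a policy; it
    makes every single summand nonnegative, by the tangent inequality, while
    the terms of the entropy themselves can have either sign. *)
Definition entropy_defect nu phi (x : S * U) : \bar R :=
  (entropy_term nu phi x
   - (nu x - phi x.1 x.2 * state_marginal nu x.1)%:E)%E.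

Lemma entropy_defect_ge0 nu phi x : (forall x, 0 <= nu x) -> is_policy phi ->
  (0 <= entropy_defect nu phi x)%E /\
  (entropy_defect nu phi x = 0%E ->
   nu x = phi x.1 x.2 * state_marginal nu x.1).
Proof.
move=> nu0 phiP; rewrite /entropy_defect /entropy_term.
have p0 : 0 <= phi x.1 x.2 by case: (phiP x.1).
have m0 := state_marginal_ge0 x.1 nu0.
case: eqVneq => [->|nux].
  rewrite !sub0r -EFinN add0e lee_fin opprK mulr_ge0//; split=> //.
  by case=> <-.
case: eqVneq => [_|phix]; first by rewrite addye ?leey; split.
have nux0 : 0 < nu x by rewrite lt_neqAle eq_sym nux nu0.
have mx0 : 0 < state_marginal nu x.1 by exact: state_marginal_gt0.
have phix0 : 0 < phi x.1 x.2 by rewrite lt_neqAle eq_sym phix p0.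
rewrite -mulrA -invfM [state_marginal nu x.1 * _]mulrC.
have := xlnx_tangent_le nux0 (mulr_gt0 phix0 mx0).
case=> le eqiff; rewrite -EFinB lee_fin subr_ge0; split=> // eq0.
have /eqP := EFin_inj eq0.
by rewrite subr_eq0 eq_sym eqiff => /eqP.
Qed.

Lemma rel_entropy_defect nu phi : is_policy phi ->
  rel_entropy nu phi = (\sum_x entropy_defect nu phi x)%E.
Proof.
move=> phiP; rewrite /entropy_defect big_split /=.
rewrite [X in (_ + X)%E](eq_bigr (fun x =>
    (- (nu x - phi x.1 x.2 * state_marginal nu x.1))%:E)); last first.
  by move=> x _; rewrite EFinN.
rewrite sumEFin sumrN sumrB -sum_state_marginal.
have -> : \sum_x phi x.1 x.2 * state_marginal nu x.1 =
    \sum_s state_marginal nu s.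
  rewrite -(pair_bigA _ (fun s u => phi s u * state_marginal nu s)) /=.
  apply: eq_bigr => s _; rewrite -mulr_suml.
  by case: (phiP s) => _ ->; rewrite mul1r.
by rewrite subrr oppr0 adde0.
Qed.

Lemma rel_entropy_ge0 nu phi : (forall x, 0 <= nu x) -> is_policy phi ->
  (0 <= rel_entropy nu phi)%E.
Proof.
move=> nu0 phiP; rewrite rel_entropy_defect//; apply: sume_ge0 => x _.
by case: (entropy_defect_ge0 x nu0 phiP).
Qed.

Lemma rel_entropy_eq0 nu phi : (forall x, 0 <= nu x) -> is_policy phi ->
  rel_entropy nu phi = 0%E <->
  forall s u, nu (s, u) = phi s u * state_marginal nu s.
Proof.
move=> nu0 phiP; split=> [|nuE].
  rewrite rel_entropy_defect// => /sume_eq0_ge0 h s u.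
  case: (entropy_defect_ge0 (s, u) nu0 phiP) => _ /=; apply; apply: h.
  by move=> x; case: (entropy_defect_ge0 x nu0 phiP).
rewrite /rel_entropy big1// => -[s u] _.
case: eqVneq => // nux.
have m0 : 0 < state_marginal nu s by exact: (@state_marginal_gt0 nu (s, u)).
have p0 : phi s u != 0.
  by apply: contra_neq nux => p0; rewrite nuE p0 mul0r.
rewrite nuE /= mulfK ?(negbTE p0) ?(gt_eqF m0)//.
by rewrite divff// ln1 mulr0.
Qed.

(** A change of reference policy is additive.  Both sides are [+oo] together
    since the two policies have the same support. *)
Lemma rel_entropy_tilt nu phi0 phi (w : S -> U -> R) :
  (forall x, 0 <= nu x) -> is_policy phi0 ->
  (forall s u, phi s u = phi0 s u * expR (w s u)) ->
  rel_entropy nu phi0 =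
  (rel_entropy nu phi + (\sum_x nu x * w x.1 x.2)%:E)%E.
Proof.
move=> nu0 phi0P phiE.
rewrite /rel_entropy -sumEFin -big_split /=; apply: eq_bigr => x _.
case: eqVneq => [->|nux]; first by rewrite mul0r add0e.
rewrite phiE mulf_eq0 (gt_eqF (expR_gt0 _)) orbF.
case: eqVneq => [//|p0].
have nux0 : 0 < nu x by rewrite lt_neqAle eq_sym nux nu0.
have px0 : 0 < phi0 x.1 x.2.
  by rewrite lt_neqAle eq_sym p0; case: (phi0P x.1) => ->.
have mx0 : 0 < state_marginal nu x.1 by exact: state_marginal_gt0.
rewrite -EFinD -mulrDr; congr (_ * _)%:E.
rewrite -[X in _ + X]expRK -lnM ?posrE ?expR_gt0 ?divr_gt0 ?mulr_gt0 ?expR_gt0//.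
congr ln; field.
by rewrite !gt_eqF// expR_gt0.
Qed.

End RelativeEntropy.

(** * Completing the Lagrangian *)

Section Duality.
Variables (R : realType) (S U : finType).
Variables (K : nat) (kappa : R) (Y : S * U -> R) (r : nat -> R).
Variables (T : nat -> S * U -> S -> R) (phi0 : nat -> S -> U -> R).
Variable nu00 : S * U -> R.
Hypothesis kappa_gt0 : 0 < kappa.
Hypothesis phi0_policy : forall k, (1 <= k <= K)%N -> is_policy (phi0 k).
Implicit Types (nu : nat -> S * U -> R) (gamma lam : nat -> R) (g : nat -> S -> R).

Definition gibbs_policy lam g k s u : R :=
  phi0 k s u * expR (exponent Y T lam g k s u - g k s).

Definition dual_value lam g : R :=
  \sum_(1 <= k < K.+1) (lam k * r k - lam k ^+ 2 / (2 * kappa))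
  - \sum_x nu00 x * \sum_s' T 0 x s' * g 1 s'.

Definition constraint_pairing nu gamma lam g : R :=
  \sum_(1 <= k < K.+1) lam k * (gamma k + r k - pairing (nu k) Y)
  + \sum_(1 <= k < K.+1) \sum_(s' : S)
      (state_marginal (nu k) s' - \sum_(x : S * U) nu k.-1 x * T k.-1 x s')
        * g k s'.

(** The remainder after minimizing [kappa / 2 * gamma ^+ 2 + lam * gamma] over
    [gamma]; the minimum is [- lam ^+ 2 / (2 * kappa)]. *)
Definition square_residual gamma lam : R :=
  kappa / 2 * \sum_(1 <= k < K.+1) (gamma k + lam k / kappa) ^+ 2.

Definition policy_gap nu lam g : \bar R :=
  (\sum_(1 <= k < K.+1) rel_entropy (nu k) (gibbs_policy lam g k))%E.

(** With [A k] the pairing of [nu k] with the expected value of [g k.+1] and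
    [B k] that of its state marginal with [g k], the exponent contributes
    [A k - B k] and the dynamics constraint [B k - A k.-1]; together they
    telescope to [A K - A 0], and [A K = 0] by the terminal condition. *)
Lemma sum_exponent nu gamma lam g :
  nu 0 = nu00 -> (forall s, g K.+1 s = 0) ->
  \sum_(1 <= k < K.+1)
     \sum_x nu k x * (exponent Y T lam g k x.1 x.2 - g k x.1)
   + kappa / 2 * \sum_(1 <= k < K.+1) gamma k ^+ 2
  = dual_value lam g + square_residual gamma lam
    - constraint_pairing nu gamma lam g.
Proof.
move=> nu0E gK.
pose A k := \sum_x nu k x * \sum_s' T k x s' * g k.+1 s'.
pose B k := \sum_s state_marginal (nu k) s * g k s.
have termE k : \sum_x nu k x * (exponent Y T lam g k x.1 x.2 - g k x.1)
    = A k + lam k * pairing (nu k) Y - B k.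
  rewrite /B -sum_pairing_state /A /pairing mulr_sumr -big_split -sumrB /=.
  by apply: eq_bigr => -[s u] _; rewrite /exponent /=; ring.
have flowE k : \sum_s' (state_marginal (nu k) s'
      - \sum_x nu k.-1 x * T k.-1 x s') * g k s'
    = B k - \sum_x nu k.-1 x * \sum_s' T k.-1 x s' * g k s'.
  rewrite (eq_bigr (fun s' => state_marginal (nu k) s' * g k s'
     - \sum_x nu k.-1 x * T k.-1 x s' * g k s')); last first.
    by move=> s _; rewrite mulrBl; congr (_ - _); rewrite mulr_suml.
  rewrite sumrB exchange_big /=; congr (_ - _); apply: eq_bigr => x _.
  by rewrite mulr_sumr; apply: eq_bigr => s _; rewrite mulrA.
have telE : \sum_(1 <= k < K.+1) (A k - A k.-1)
    = - \sum_x nu00 x * \sum_s' T 0 x s' * g 1 s'.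
  rewrite big_add1 /= telescope_sumr// {1}/A big1 ?sub0r ?/A ?nu0E//.
  by move=> x _; rewrite big1 ?mulr0// => s _; rewrite gK mulr0.
rewrite /dual_value /square_residual /constraint_pairing -telE.
rewrite !mulr_sumr opprD -!sumrN -!big_split /=.
rewrite !big_nat; apply: eq_bigr => k /andP[k1 _].
rewrite termE flowE /A prednK//.
by field; rewrite gt_eqF.
Qed.

Lemma klq_cost_decomposition nu gamma lam g :
  marginals K nu00 nu -> (forall s, g K.+1 s = 0) ->
  klq_cost K kappa phi0 nu gamma =
  (policy_gap nu lam g + (dual_value lam g + square_residual gamma lam
      - constraint_pairing nu gamma lam g)%:E)%E.
Proof.
move=> [nu0E nuP] gK; rewrite -sum_exponent// EFinD addeA; congr (_ + _)%E.
rewrite -sumEFin -big_split /= !big_nat; apply: eq_bigr => k kK.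
have [nuk0 _] := nuP _ kK.
by rewrite (rel_entropy_tilt (phi := gibbs_policy lam g k)
  (w := fun s u => exponent Y T lam g k s u - g k s) nuk0 (phi0_policy kK)).
Qed.

Lemma lagrangian_decomposition nu gamma lam g :
  marginals K nu00 nu -> (forall s, g K.+1 s = 0) ->
  lagrangian K kappa Y r T phi0 nu gamma lam g =
  (policy_gap nu lam g + (dual_value lam g + square_residual gamma lam)%:E)%E.
Proof.
move=> nuP gK; rewrite /lagrangian (klq_cost_decomposition gamma lam nuP gK)//.
by rewrite -addeA -EFinD subrK.
Qed.

End Duality.

(** * Continuity of real expressions *)

Section ContinuityRules.
Variables (R : realType) (X : topologicalType).

Lemma continuous_sum (I : Type) (s : seq I) (P : pred I) (F : I -> X -> R) :
  (forall i, P i -> continuous (F i)) ->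
  continuous (fun x => \sum_(i <- s | P i) F i x).
Proof. by move=> Fc; apply: continuous_big => //; exact: add_continuous. Qed.

Lemma continuous_mulr (F G : X -> R) :
  continuous F -> continuous G -> continuous (fun x => F x * G x).
Proof. by move=> Fc Gc x; apply: continuousM; [exact: Fc|exact: Gc]. Qed.

Lemma continuous_addr (F G : X -> R) :
  continuous F -> continuous G -> continuous (fun x => F x + G x).
Proof. by move=> Fc Gc x; apply: continuousD; [exact: Fc|exact: Gc]. Qed.

Lemma continuous_oppr (F : X -> R) :
  continuous F -> continuous (fun x => - F x).
Proof. by move=> Fc x; apply: continuousN; exact: Fc. Qed.

Lemma continuous_cst (c : R) : continuous (fun _ : X => c).
Proof. by move=> x; exact: cvg_cst. Qed.

Lemma continuous_expR_comp (F : X -> R) :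
  continuous F -> continuous (fun x => expR (F x)).
Proof.
move=> Fc x; apply: (@continuous_comp _ _ _ F (@expR R)); first exact: Fc.
exact: continuous_expR.
Qed.

End ContinuityRules.

(** * Critical points of strongly concave functions *)

Section StronglyConcave.
Variables (R : realType) (n : nat) (f : 'rV[R]_n -> R).
Variables (grad : 'rV[R]_n -> 'I_n -> R) (c : R).
Hypothesis c_gt0 : 0 < c.
Hypothesis f_continuous : continuous f.
Hypothesis grad_continuous : forall i, continuous (fun x => grad x i).
Hypothesis f_le : forall x y, f y <=
  f x + \sum_i (y ord0 i - x ord0 i) * grad x i
  - c * \sum_i (y ord0 i - x ord0 i) ^+ 2.

(** On the superlevel set of [f 0] the bound at [x = 0] gives
    [c * |y|^2 <= <y, grad 0>]; half of the left side is absorbed by Young's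
    inequality, leaving [|y|^2 <= |grad 0 / c|^2]. *)
Lemma strongly_concave_superlevel_bounded :
  exists M, 0 <= M /\ forall y, f 0 <= f y -> forall i, `|y ord0 i| <= M.
Proof.
pose B := \sum_i (grad 0 i / c) ^+ 2.
have B0 : 0 <= B by apply: sumr_ge0 => i _; exact: sqr_ge0.
exists (1 + B); split=> [|y fy i]; first by rewrite addr_ge0.
have : \sum_i (y ord0 i) ^+ 2 <= B.
  have /(le_trans fy) := f_le 0 y.
  rewrite -addrA lerDl subr_ge0 => h.
  have h2 : \sum_i (y ord0 i - (0 : 'rV[R]_n) ord0 i) * grad 0 i <=
      c / 2 * \sum_i (y ord0 i) ^+ 2 + c / 2 * B.
    rewrite !mulr_sumr -big_split; apply: ler_sum => j _ /=; rewrite mxE subr0.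
    rewrite -subr_ge0.
    have -> : c / 2 * y ord0 j ^+ 2 + c / 2 * (grad 0 j / c) ^+ 2
       - y ord0 j * grad 0 j = c / 2 * (y ord0 j - grad 0 j / c) ^+ 2.
      by field; rewrite gt_eqF.
    by rewrite mulr_ge0 ?sqr_ge0 ?divr_ge0// ltW.
  have {}h := le_trans h h2.
  move: h; rewrite (eq_bigr (fun i => (y ord0 i) ^+ 2)) => [|j _]; last first.
    by rewrite mxE subr0.
  set s := \sum_i _ => h; rewrite -(ler_pM2l c_gt0); lra.
rewrite (bigD1 i)//= => h.
have yB : y ord0 i ^+ 2 <= B.
  by apply: le_trans h; rewrite lerDl; apply: sumr_ge0 => j _; exact: sqr_ge0.
(* [|y i| > 1 + B] is absurd since [(1 + B)^2 > B]. *)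
rewrite leNgt; apply/negP => lt.
have : (1 + B) ^+ 2 < `|y ord0 i| ^+ 2.
  by rewrite ltr_pXn2r// nnegrE ?addr_ge0.
rewrite real_normK ?num_real//; nra.
Qed.

Lemma strongly_concave_max : exists x, forall y, f y <= f x.
Proof.
have [M [M0 fM]] := strongly_concave_superlevel_bounded.
pose A := [set v : 'rV[R]_n | forall i, `[- M, M]%classic (v ord0 i)]%classic.
have A0 : A 0 by move=> i /=; rewrite mxE in_itv/= oppr_le0 M0.
have cA : compact A.
  apply: (@rV_compact R n (fun=> `[- M, M]%classic)) => i.
  exact: segment_compact.
have [x _ xmax] := EVT_max_rV (ex_intro _ _ A0) cA (continuous_subspaceT f_continuous).
exists x => y; have [fy|/ltW fy] := leP (f 0) (f y).
  by apply: xmax; rewrite inE => i /=; rewrite in_itv/= -ler_norml fM.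
by apply: le_trans fy _; apply: xmax; rewrite inE.
Qed.

(** At a maximum [x], let [d = grad x].  The bound from [x + e d] back to [x]
    gives [<d, grad (x + e d)> <= 0] for [e > 0]; continuity of [grad] as
    [e] tends to [0] gives [<d, d> <= 0]. *)
Lemma strongly_concave_critical : exists x, forall i, grad x i = 0.
Proof.
have [x xmax] := strongly_concave_max; exists x.
pose d : 'rV[R]_n := \row_i grad x i.
have le0 e : 0 < e -> \sum_i grad x i * grad (x + e *: d) i <= 0.
  move=> e0; rewrite -(pmulr_rle0 _ e0).
  have := f_le (x + e *: d) x; set sq := c * _ => h.
  have sq0 : 0 <= sq.
    by apply: mulr_ge0; [exact: ltW|apply: sumr_ge0 => i _; exact: sqr_ge0].
  have : \sum_i (x ord0 i - (x + e *: d) ord0 i) * grad (x + e *: d) i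
      = - (e * \sum_i grad x i * grad (x + e *: d) i).
    by rewrite mulr_sumr -sumrN; apply: eq_bigr => i _; rewrite !mxE; ring.
  have := xmax (x + e *: d); lra.
have line_continuous : continuous (fun e : R => x + e *: d).
  move=> e; apply: cvgD; first exact: cvg_cst.
  exact: scalel_continuous.
have lim : ((fun e => \sum_i grad x i * grad (x + e *: d) i) e @[e --> (0:R)^'+]
    --> \sum_i grad x i * grad x i)%classic.
  apply: cvg_big; first exact: add_continuous.
  move=> i _; apply: cvgM; first exact: cvg_cst.
  apply: cvg_at_right_filter.
  rewrite -[X in (_ --> grad X i)%classic]addr0 -[X in _ + X](scale0r d).
  apply: (@continuous_comp _ _ _ (fun e : R => x + e *: d) (grad^~ i)).
    exact: line_continuous.
  exact: grad_continuous.
have : \sum_i grad x i * grad x i <= 0.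
  apply: (cvgr_to_le lim); near=> e; apply: le0.
  by near: e; exact: nbhs_right_gt.
move=> sum_le0 i; apply/eqP; rewrite -sqrf_eq0 expr2 eq_le -expr2 sqr_ge0 andbT.
apply: le_trans sum_le0; rewrite (bigD1 i)//= expr2 lerDl.
by apply: sumr_ge0 => j _; rewrite -expr2 sqr_ge0.
Unshelve. all: by end_near. Qed.

End StronglyConcave.

(** * Marginals generated by a sequence of policies *)

Section Flow.
Variables (R : realType) (S U : finType) (K : nat).
Variables (T : nat -> S * U -> S -> R) (nu00 : S * U -> R).
Implicit Types (nu : nat -> S * U -> R) (phi : nat -> S -> U -> R).

Definition obeys_dynamics nu : Prop := forall k, (1 <= k <= K)%N ->
  forall s', state_marginal (nu k) s' = \sum_x nu k.-1 x * T k.-1 x s'.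

Fixpoint flow phi k : S * U -> R :=
  if k is k'.+1 then
    fun x => phi k x.1 x.2 * \sum_y flow phi k' y * T k' y x.1
  else nu00.

Lemma flow_dynamics phi : (forall k, (1 <= k <= K)%N -> is_policy (phi k)) ->
  obeys_dynamics (flow phi).
Proof.
move=> phiP [//|k] kK s; rewrite /state_marginal /= -mulr_suml.
by case: (phiP _ kK s) => _ ->; rewrite mul1r.
Qed.

Lemma flow_conditional phi k s u :
  (forall k, (1 <= k <= K)%N -> is_policy (phi k)) -> (1 <= k <= K)%N ->
  flow phi k (s, u) = phi k s u * state_marginal (flow phi k) s.
Proof. by move=> phiP kK; rewrite flow_dynamics//; case: k kK. Qed.

Lemma flow_pmf phi k : (forall k, (1 <= k <= K)%N -> is_policy (phi k)) ->
  (forall k x, (k <= K)%N -> is_pmf (T k x)) -> is_pmf nu00 ->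
  (k <= K)%N -> is_pmf (flow phi k).
Proof.
move=> phiP TP nu00P; elim: k => [//|k IH] kK.
have [fl0 fl1] := IH (ltnW kK).
split=> [[s u] /=|].
  apply: mulr_ge0; first by case: (phiP k.+1 kK s) => ->.
  apply: sumr_ge0 => y _; apply: mulr_ge0 => //.
  by case: (TP k y (ltnW kK)).
rewrite -sum_state_marginal.
have dyn := flow_dynamics phiP (k := k.+1) kK.
rewrite (eq_bigr _ (fun s _ => dyn s)) exchange_big /=.
rewrite -[RHS]fl1; apply: eq_bigr => y _; rewrite -mulr_sumr.
by case: (TP k y (ltnW kK)) => _ ->; rewrite mulr1.
Qed.

Lemma flow_unique phi nu : nu 0%N = nu00 -> obeys_dynamics nu ->
  (forall k s u, (1 <= k <= K)%N ->
     nu k (s, u) = phi k s u * state_marginal (nu k) s) ->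
  forall k x, (k <= K)%N -> nu k x = flow phi k x.
Proof.
move=> nu0 dyn cond; elim=> [|k IH] [s u] kK /=; first by rewrite nu0.
rewrite cond// dyn//=; congr (_ * _); apply: eq_bigr => y _.
by rewrite IH // ltnW.
Qed.

End Flow.

(** * The dual problem *)

Section DualProblem.
Variables (R : realType) (S U : finType).
Variables (K : nat) (kappa : R) (Y : S * U -> R) (r : nat -> R).
Variables (T : nat -> S * U -> S -> R) (phi0 : nat -> S -> U -> R).
Variable nu00 : S * U -> R.
Hypothesis kappa_gt0 : 0 < kappa.
Hypothesis T_pmf : forall k x, (k <= K)%N -> is_pmf (T k x).
Hypothesis phi0_policy : forall k, (1 <= k <= K)%N -> is_policy (phi0 k).
Hypothesis nu00_pmf : is_pmf nu00.
Implicit Types (nu : nat -> S * U -> R) (gamma lam : nat -> R) (g : nat -> S -> R).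

Notation gibbs_policy := (gibbs_policy Y T phi0).
Notation cost := (klq_cost K kappa phi0).
Notation dual_value := (dual_value K kappa r T nu00).
Notation dual := (dual_function K kappa Y r T phi0 nu00).
Notation recursion := (log_partition_recursion K Y T phi0).

(** Some action has positive nominal probability. *)
Lemma partition_gt0 k s (e : U -> R) : (1 <= k <= K)%N ->
  0 < \sum_u phi0 k s u * expR (e u).
Proof.
move=> kK; have [p0 p1] := phi0_policy kK s.
rewrite lt_neqAle sumr_ge0 ?andbT; last first.
  by move=> u _; rewrite mulr_ge0 ?expR_ge0.
apply/negP => /eqP/esym sum0.
have term0 := psumr_eq0P (fun u _ => mulr_ge0 (p0 u) (expR_ge0 (e u))) sum0.
move: p1; rewrite big1 => [/esym/eqP|u _]; first by rewrite oner_eq0.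
by have /eqP := term0 u isT; rewrite mulf_eq0 (gt_eqF (expR_gt0 _)) orbF => /eqP.
Qed.

Lemma gibbs_policyP lam g k : recursion lam g -> (1 <= k <= K)%N ->
  is_policy (gibbs_policy lam g k).
Proof.
move=> [_ gE] kK s; have [p0 _] := phi0_policy kK s; split=> [u|].
  by rewrite mulr_ge0 ?expR_ge0.
rewrite /gibbs_policy.
rewrite (eq_bigr (fun u =>
    phi0 k s u * expR (exponent Y T lam g k s u) * expR (- g k s))).
  rewrite -mulr_suml gE// expRN lnK ?posrE ?partition_gt0// divff//.
  by rewrite gt_eqF// partition_gt0.
by move=> u _; rewrite expRD mulrA.
Qed.

(** The log-partition recursion runs backwards from the horizon, so the solution
    is defined by recursion on the number [j] of remaining steps; the time is
    then [K.+1 - j]. *)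
Fixpoint value_to_go lam j s : R :=
  if j is j'.+1 then
    ln (\sum_u phi0 (K - j') s u *
      expR (\sum_s' T (K - j') (s, u) s' * value_to_go lam j' s'
            + lam (K - j')%N * Y (s, u)))
  else 0.

Lemma value_to_goS lam j s : value_to_go lam j.+1 s =
  ln (\sum_u phi0 (K - j)%N s u *
      expR (\sum_s' T (K - j)%N (s, u) s' * value_to_go lam j s'
            + lam (K - j)%N * Y (s, u))).
Proof. by []. Qed.

Definition value_fn lam k s := value_to_go lam (K.+1 - k) s.

Lemma value_fn_recursion lam : recursion lam (value_fn lam).
Proof.
split=> [s|k s /andP[k1 kK]]; first by rewrite /value_fn subnn.
by rewrite {1}/value_fn subSn//= subKn// /exponent /value_fn subSS.
Qed.

Lemma recursion_unique lam lam' g : recursion lam g ->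
  (forall k, (1 <= k <= K)%N -> lam k = lam' k) ->
  forall k s, (1 <= k <= K.+1)%N -> g k s = value_fn lam' k s.
Proof.
move=> [gK gE] lamE.
have H j s : (j <= K)%N -> g (K.+1 - j)%N s = value_to_go lam' j s.
  elim: j s => [|j IH] s jK; first by rewrite subn0 gK.
  have kK : (1 <= K - j <= K)%N by rewrite subn_gt0 jK leq_subr.
  rewrite subSS (gE _ _ kK) value_to_goS.
  apply: (congr1 (@ln R)); apply: eq_bigr => u _.
  rewrite /exponent (lamE _ kK).
  rewrite (eq_bigr (fun s' => T (K - j)%N (s, u) s' * value_to_go lam' j s'))//.
  by move=> s' _; rewrite -IH ?(ltnW jK)// subSn// ltnW.
move=> k s /andP[k1 kK]; rewrite /value_fn -H ?subKn//.
by rewrite leq_subLR -addn1 addnC leq_add2r.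
Qed.

Definition gibbs_flow lam :=
  flow T nu00 (gibbs_policy lam (value_fn lam)).

Definition dual_obj lam := dual_value lam (value_fn lam).

(** By [dual_obj_strongly_concave] this is a supergradient of [dual_obj]; its
    zeros are the [lam] whose flow satisfies the tracking constraint with
    [gamma = - lam / kappa]. *)
Definition dual_grad lam k :=
  r k - lam k / kappa - pairing (gibbs_flow lam k) Y.

Lemma value_policyP lam k : (1 <= k <= K)%N ->
  is_policy (gibbs_policy lam (value_fn lam) k).
Proof. exact/gibbs_policyP/value_fn_recursion. Qed.

Lemma gibbs_flow_marginals lam : marginals K nu00 (gibbs_flow lam).
Proof.
split=> // k /andP[_ kK]; apply: (flow_pmf (K := K)) => //.
exact: value_policyP.
Qed.

Lemma gibbs_flow_dynamics lam : obeys_dynamics K T (gibbs_flow lam).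
Proof. exact/flow_dynamics/value_policyP. Qed.

Lemma policy_gap_ge0 nu lam g : marginals K nu00 nu -> recursion lam g ->
  (0 <= policy_gap K Y T phi0 nu lam g)%E.
Proof.
move=> [_ nuP] gR; rewrite /policy_gap big_nat; apply: sume_ge0 => k kK.
by apply: rel_entropy_ge0; [case: (nuP _ kK)|exact: gibbs_policyP].
Qed.

Lemma policy_gap_eq0 nu lam g : marginals K nu00 nu -> recursion lam g ->
  policy_gap K Y T phi0 nu lam g = 0%E <->
  forall k s u, (1 <= k <= K)%N ->
    nu k (s, u) = gibbs_policy lam g k s u * state_marginal (nu k) s.
Proof.
move=> [_ nuP] gR.
have nu_ge0 k : (1 <= k <= K)%N -> forall x, 0 <= nu k x.
  by move=> kK; case: (nuP _ kK).
split=> [|nuE].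
  rewrite /policy_gap big_add1 /= big_mkord => /sume_eq0_ge0 gap0 [//|k] s u kK.
  apply: (proj1 (rel_entropy_eq0 (nu_ge0 _ kK) (gibbs_policyP gR kK))).
  have kK' : (k < K)%N by case/andP: kK.
  apply: (gap0 _ (Ordinal kK')) => i.
  have iK : (1 <= i.+1 <= K)%N := ltn_ord i.
  exact: rel_entropy_ge0 (nu_ge0 _ iK) (gibbs_policyP gR iK).
rewrite /policy_gap big_nat big1// => k kK.
apply: (proj2 (rel_entropy_eq0 (nu_ge0 _ kK) (gibbs_policyP gR kK))).
by move=> s u; apply: nuE.
Qed.

Lemma gibbs_gap0 lam :
  policy_gap K Y T phi0 (gibbs_flow lam) lam (value_fn lam) = 0%E.
Proof.
apply/policy_gap_eq0; [exact: gibbs_flow_marginals|exact: value_fn_recursion|].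
move=> k s u kK; rewrite {1}/gibbs_flow (@flow_conditional _ _ _ K)//.
exact: value_policyP.
Qed.

Lemma constraint_pairing_dynamics nu gamma lam g : obeys_dynamics K T nu ->
  constraint_pairing K Y r T nu gamma lam g =
  \sum_(1 <= k < K.+1) lam k * (gamma k + r k - pairing (nu k) Y).
Proof.
move=> dyn; rewrite /constraint_pairing.
rewrite [X in _ + X]big_nat [X in _ + X]big1 ?addr0// => k kK.
by rewrite big1// => s _; rewrite dyn// subrr mul0r.
Qed.

Lemma square_residual_ge0 gamma lam : 0 <= square_residual K kappa gamma lam.
Proof.
apply: mulr_ge0; first by rewrite divr_ge0 ?ltW.
by apply: sumr_ge0 => k _; exact: sqr_ge0.
Qed.

(** Both remainders of the completed Lagrangian are nonnegative.  Equality
    holds, by [dual_le_quadratic] at [lam' = lam]. *)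
Lemma dual_obj_le_dual lam :
  ((dual_obj lam)%:E <= dual lam (value_fn lam))%E.
Proof.
apply/ereal_infP => _ [nu [gamma [nuP ->]]].
have gR := value_fn_recursion lam.
rewrite (lagrangian_decomposition Y r T kappa_gt0 phi0_policy gamma lam nuP (proj1 gR)).
apply: le_trans (leeDr _ (policy_gap_ge0 nuP gR)).
by rewrite lee_fin lerDl square_residual_ge0.
Qed.

(** The infimum is bounded by the Lagrangian at the flow of [lam], with [gamma]
    optimal for [lam'].  The flow obeys the dynamics, which removes [g'], and
    has zero policy gap with respect to [lam], which makes its cost explicit. *)
Lemma dual_le_quadratic lam lam' g' :
  (dual lam' g' <=
   (dual_obj lam + \sum_(1 <= k < K.+1) (lam' k - lam k) * dual_grad lam k
    - (2 * kappa)^-1 * \sum_(1 <= k < K.+1) (lam' k - lam k) ^+ 2)%:E)%E.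
Proof.
have gR := value_fn_recursion lam.
have nuP := gibbs_flow_marginals lam.
have dyn := gibbs_flow_dynamics lam.
pose gamma k := - lam' k / kappa.
apply: ge_ereal_inf.
exists (lagrangian K kappa Y r T phi0 (gibbs_flow lam) gamma lam' g').
  by exists (gibbs_flow lam), gamma.
rewrite /lagrangian.
rewrite (klq_cost_decomposition Y r T kappa_gt0 phi0_policy gamma lam nuP (proj1 gR)).
rewrite gibbs_gap0 add0e -EFinD lee_fin.
rewrite -/(constraint_pairing K Y r T (gibbs_flow lam) gamma lam' g').
rewrite !constraint_pairing_dynamics// /square_residual.
rewrite -/(dual_obj lam); move: (dual_obj lam) => D.
rewrite -!addrA lerD2l !mulr_sumr -!sumrN -!big_split /=.
apply: ler_sum => k _; rewrite /dual_grad /gamma.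
by rewrite le_eqVlt; apply/orP; left; apply/eqP; field; rewrite gt_eqF.
Qed.

Lemma dual_obj_strongly_concave lam lam' :
  dual_obj lam' <=
   dual_obj lam + \sum_(1 <= k < K.+1) (lam' k - lam k) * dual_grad lam k
    - (2 * kappa)^-1 * \sum_(1 <= k < K.+1) (lam' k - lam k) ^+ 2.
Proof.
by rewrite -lee_fin; apply: le_trans (dual_obj_le_dual _) (dual_le_quadratic _ _ _).
Qed.

Section Continuity.
Variables (X : topologicalType) (lam : X -> nat -> R).
Hypothesis lam_continuous : forall k, continuous (fun x => lam x k).

Lemma value_to_go_continuous j s : (j <= K)%N ->
  continuous (fun x => value_to_go (lam x) j s).
Proof.
elim: j s => [|j IH] s jK /=; first exact: continuous_cst.
have kK : (1 <= K - j <= K)%N by rewrite subn_gt0 jK leq_subr.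
move=> x; apply: (@continuous_comp _ _ _ _ (@ln R)); last first.
  by apply: continuous_ln; exact: partition_gt0.
apply: continuous_sum => u _; apply: continuous_mulr; first exact: continuous_cst.
apply/continuous_expR_comp/continuous_addr.
  apply: continuous_sum => s' _; apply: continuous_mulr; first exact: continuous_cst.
  by apply: IH; exact: ltnW.
by apply: continuous_mulr => //; exact: continuous_cst.
Qed.

Lemma value_fn_continuous k s : (1 <= k)%N ->
  continuous (fun x => value_fn (lam x) k s).
Proof.
move=> k1; apply: value_to_go_continuous.
by rewrite leq_subLR -addn1 addnC leq_add2r.
Qed.

Lemma gibbs_flow_continuous k y : (k <= K)%N ->
  continuous (fun x => gibbs_flow (lam x) k y).
Proof.
elim: k y => [|k IH] y kK; first exact: continuous_cst.
rewrite /gibbs_flow /=; apply: continuous_mulr.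
  apply: continuous_mulr; first exact: continuous_cst.
  apply: continuous_expR_comp; apply: continuous_addr; last first.
    by apply: continuous_oppr; exact: value_fn_continuous.
  apply: continuous_addr; last first.
    by apply: continuous_mulr => //; exact: continuous_cst.
  apply: continuous_sum => s' _; apply: continuous_mulr; first exact: continuous_cst.
  exact: value_fn_continuous.
apply: continuous_sum => z _; apply: continuous_mulr; last exact: continuous_cst.
by apply: IH; exact: ltnW.
Qed.

Lemma dual_grad_continuous k : (1 <= k <= K)%N ->
  continuous (fun x => dual_grad (lam x) k).
Proof.
move=> /andP[_ kK]; apply: continuous_addr; last first.
  apply: continuous_oppr; apply: continuous_sum => y _.
  apply: continuous_mulr; last exact: continuous_cst.
  exact: gibbs_flow_continuous.
apply: continuous_addr; first exact: continuous_cst.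
apply/continuous_oppr/continuous_mulr => //; exact: continuous_cst.
Qed.

Lemma dual_obj_continuous : continuous (fun x => dual_obj (lam x)).
Proof.
apply: continuous_addr; last first.
  apply: continuous_oppr; apply: continuous_sum => y _.
  apply: continuous_mulr; first exact: continuous_cst.
  apply: continuous_sum => s _; apply: continuous_mulr; first exact: continuous_cst.
  exact: value_fn_continuous.
apply: continuous_sum => k _; apply: continuous_addr.
  by apply: continuous_mulr => //; exact: continuous_cst.
apply: continuous_oppr; apply: continuous_mulr; last exact: continuous_cst.
by apply: continuous_mulr.
Qed.

End Continuity.

(** Multipliers are indexed by the times [1, ..., K], row vectors by
    [0, ..., K - 1]; the value outside this range is arbitrary. *)
Definition multiplier_of_row (x : 'rV[R]_K) k : R :=
  if k is k'.+1 then if insub k' is Some i then x ord0 i else 0 else 0.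

Lemma multiplier_of_rowE x (i : 'I_K) : multiplier_of_row x i.+1 = x ord0 i.
Proof. by rewrite /= valK. Qed.

Lemma multiplier_of_row_continuous k :
  continuous (fun x => multiplier_of_row x k).
Proof.
case: k => [|k] /=; first exact: continuous_cst.
by case: insub => [i|]; [exact: coord_continuous|exact: continuous_cst].
Qed.

Lemma dual_grad_zero :
  exists lam, forall k, (1 <= k <= K)%N -> dual_grad lam k = 0.
Proof.
have c0 : 0 < (2 * kappa)^-1 by rewrite invr_gt0 mulr_gt0.
have [|i||x x0] := @strongly_concave_critical R K
  (fun x => dual_obj (multiplier_of_row x))
  (fun x i => dual_grad (multiplier_of_row x) i.+1) _ c0.
- exact/dual_obj_continuous/multiplier_of_row_continuous.
- apply: dual_grad_continuous; first exact: multiplier_of_row_continuous.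
  exact: ltn_ord.
- move=> x y.
  have := dual_obj_strongly_concave (multiplier_of_row x) (multiplier_of_row y).
  rewrite !big_add1 !big_mkord.
  under eq_bigr => i _ do rewrite !multiplier_of_rowE.
  by under [X in _ * X]eq_bigr => i _ do rewrite !multiplier_of_rowE.
exists (multiplier_of_row x) => -[//|k] kK.
exact: (x0 (Ordinal (kK : (k < K)%N))).
Qed.

Lemma feasible_dynamics nu gamma :
  klq_feasible K Y r T nu00 nu gamma -> obeys_dynamics K T nu.
Proof. by move=> [_ h] k kK; case: (h k kK). Qed.

Lemma feasible_constraint_pairing nu gamma lam g :
  klq_feasible K Y r T nu00 nu gamma ->
  constraint_pairing K Y r T nu gamma lam g = 0.
Proof.
move=> feas; rewrite (constraint_pairing_dynamics _ _ _ (feasible_dynamics feas)).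
rewrite big_nat big1// => k kK; case: feas => _ /(_ k kK)[-> _].
by rewrite subrK subrr mulr0.
Qed.

Lemma weak_duality nu gamma lam g : klq_feasible K Y r T nu00 nu gamma ->
  (dual lam g <= cost nu gamma)%E.
Proof.
move=> feas; apply: ge_ereal_inf.
exists (lagrangian K kappa Y r T phi0 nu gamma lam g).
  by exists nu, gamma; split=> //; case: feas.
rewrite /lagrangian -/(constraint_pairing K Y r T nu gamma lam g).
by rewrite feasible_constraint_pairing// adde0.
Qed.

(** * The optimum at a critical multiplier *)

Section CriticalMultiplier.
Variable lam : nat -> R.
Hypothesis lam_critical : forall k, (1 <= k <= K)%N -> dual_grad lam k = 0.

Definition gibbs_gamma k : R := pairing (gibbs_flow lam k) Y - r k.

Lemma gibbs_gammaE k : (1 <= k <= K)%N -> gibbs_gamma k = - (lam k / kappa).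
Proof.
move=> kK; have := lam_critical kK; rewrite /dual_grad /gibbs_gamma; lra.
Qed.

Lemma gibbs_feasible :
  klq_feasible K Y r T nu00 (gibbs_flow lam) gibbs_gamma.
Proof.
split; first exact: gibbs_flow_marginals.
by move=> k kK; split=> // s'; apply: gibbs_flow_dynamics.
Qed.

Lemma feasible_cost nu gamma : klq_feasible K Y r T nu00 nu gamma ->
  cost nu gamma = (policy_gap K Y T phi0 nu lam (value_fn lam)
     + (dual_obj lam + square_residual K kappa gamma lam)%:E)%E.
Proof.
move=> feas; have gR := value_fn_recursion lam.
rewrite (klq_cost_decomposition Y r T kappa_gt0 phi0_policy gamma lam
  (proj1 feas) (proj1 gR)).
by rewrite feasible_constraint_pairing// subr0.
Qed.

Lemma gibbs_cost : cost (gibbs_flow lam) gibbs_gamma = (dual_obj lam)%:E.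
Proof.
rewrite feasible_cost; last exact: gibbs_feasible.
rewrite gibbs_gap0 add0e /square_residual big_nat big1 ?mulr0 ?addr0// => k kK.
by rewrite gibbs_gammaE// addNr expr0n.
Qed.

Lemma gibbs_optimal :
  klq_optimal K kappa Y r T phi0 nu00 (gibbs_flow lam) gibbs_gamma.
Proof.
split=> [|nu' gamma' feas']; first exact: gibbs_feasible.
rewrite gibbs_cost; apply: le_trans (dual_obj_le_dual lam) _.
exact: weak_duality.
Qed.

(** An optimum has cost [dual_obj lam], which in the completed form leaves
    nothing for the policy gap and the squares. *)
Lemma optimal_unique nu gamma :
  klq_optimal K kappa Y r T phi0 nu00 nu gamma ->
  forall k, (1 <= k <= K)%N ->
    (forall x, nu k x = gibbs_flow lam k x) /\ gamma k = gibbs_gamma k.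
Proof.
move=> [feas opt].
have nuP := proj1 feas; have gR := value_fn_recursion lam.
have := opt _ _ gibbs_feasible; rewrite gibbs_cost feasible_cost//.
have gap_ge0 := policy_gap_ge0 nuP gR.
have sq_ge0 := square_residual_ge0 gamma lam.
move=> cost_le.
have [gap0 sq0] : policy_gap K Y T phi0 nu lam (value_fn lam) = 0%E /\
    square_residual K kappa gamma lam = 0.
  move: (policy_gap _ _ _ _ _ _ _) gap_ge0 cost_le => [x| |]//.
  rewrite -EFinD !lee_fin => x_ge0 xs_le.
  by split; [congr EFin|]; lra.
move=> k kK; split=> [x|].
  have [_ kK'] := andP kK.
  apply: (flow_unique (K := K)) => //; first by case: nuP.
  - exact: feasible_dynamics feas.
  - exact/(policy_gap_eq0 nuP gR).
rewrite gibbs_gammaE//; apply/eqP; rewrite -subr_eq0 opprK -sqrf_eq0.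
move/eqP: sq0; rewrite mulf_eq0 gt_eqF ?divr_gt0//= big_add1 big_mkord.
case: k kK => [//|k] kK; move=> /eqP sq0.
have := psumr_eq0P (fun (i : 'I_K) _ => sqr_ge0 (gamma i.+1 + lam i.+1 / kappa)) sq0.
by move=> /(_ (Ordinal (kK : (k < K)%N)) isT) /= ->.
Qed.

Lemma critical_multipliers :
  lagrange_multipliers K kappa Y r T phi0 nu00 lam (value_fn lam).
Proof.
move=> lam' g'; apply: le_trans (dual_obj_le_dual lam).
by rewrite -gibbs_cost; exact: weak_duality gibbs_feasible.
Qed.

(** A maximizer of the dual function has a value at least [dual_obj lam]; at a
    critical [lam] the quadratic bound is [dual_obj lam] minus a multiple of
    the squared distance of [lam'] to [lam]. *)
Lemma multipliers_unique lam' g' :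
  lagrange_multipliers K kappa Y r T phi0 nu00 lam' g' ->
  forall k, (1 <= k <= K)%N -> lam' k = lam k.
Proof.
move=> /(_ lam (value_fn lam))/(le_trans (dual_obj_le_dual lam)).
move=> /le_trans/(_ (dual_le_quadratic lam lam' g')).
rewrite lee_fin [X in _ + X - _]big_nat [X in _ + X - _]big1 => [|k kK]; last first.
  by rewrite lam_critical ?mulr0.
rewrite addr0 lerBrDl gerDr pmulr_rle0 ?invr_gt0 ?mulr_gt0// => sq_le0.
have sq0 : \sum_(i < K) (lam' i.+1 - lam i.+1) ^+ 2 = 0.
  apply/eqP; rewrite eq_le sumr_ge0 ?andbT; last by move=> i _; exact: sqr_ge0.
  by move: sq_le0; rewrite big_add1 big_mkord.
case=> [//|k] kK; apply/eqP; rewrite -subr_eq0 -sqrf_eq0.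
have := psumr_eq0P (fun (i : 'I_K) _ => sqr_ge0 (lam' i.+1 - lam i.+1)) sq0.
by move=> /(_ (Ordinal (kK : (k < K)%N)) isT) /= ->.
Qed.

End CriticalMultiplier.
End DualProblem.

(** * The optimal policies *)

Theorem theorem1p2 (R : realType) (S U : finType) (K : nat) (kappa : R)
    (Y : S * U -> R) (r : nat -> R) (T : nat -> S * U -> S -> R)
    (phi0 : nat -> S -> U -> R) (nu00 : S * U -> R)
    (K_ge1 : (1 <= K)%N) (kappa_gt0 : 0 < kappa)
    (T_pmf : forall k x, (k <= K)%N -> is_pmf (T k x))
    (phi0_policy : forall k, (1 <= k <= K)%N -> is_policy (phi0 k))
    (nu00_pmf : is_pmf nu00) :
  exists (nu : nat -> S * U -> R) (gamma : nat -> R) (phi : nat -> S -> U -> R),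
    (* existence and uniqueness of the optimal marginals *)
    klq_optimal K kappa Y r T phi0 nu00 nu gamma /\
    (forall nu' gamma', klq_optimal K kappa Y r T phi0 nu00 nu' gamma' ->
       forall k, (1 <= k <= K)%N ->
         (forall x, nu' k x = nu k x) /\ gamma' k = gamma k) /\
    (* existence and uniqueness of the associated policies *)
    (forall k, (1 <= k <= K)%N -> conditional_policy (nu k) (phi k)) /\
    (forall nu' gamma' phi', klq_optimal K kappa Y r T phi0 nu00 nu' gamma' ->
       (forall k, (1 <= k <= K)%N -> conditional_policy (nu' k) (phi' k)) ->
       forall k s u, (1 <= k <= K)%N -> 0 < state_marginal (nu k) s ->
         phi' k s u = phi k s u) /\
    (* form of the policies in terms of the Lagrange multipliers *)
    (exists lambda g, lagrange_multipliers K kappa Y r T phi0 nu00 lambda g /\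
       log_partition_recursion K Y T phi0 lambda g) /\
    (forall lambda g, lagrange_multipliers K kappa Y r T phi0 nu00 lambda g ->
       log_partition_recursion K Y T phi0 lambda g ->
       forall k s u, (1 <= k <= K)%N ->
         phi k s u = phi0 k s u * expR (exponent Y T lambda g k s u - g k s)).

Proof.
have [lam crit] := dual_grad_zero Y r kappa_gt0 T_pmf phi0_policy nu00_pmf.
pose g := value_fn K Y T phi0 lam.
have gR : log_partition_recursion K Y T phi0 lam g by exact: value_fn_recursion.
pose phi := gibbs_policy Y T phi0 lam g.
have optU := optimal_unique kappa_gt0 T_pmf phi0_policy nu00_pmf crit.
have condP k : (1 <= k <= K)%N ->
    conditional_policy (gibbs_flow K Y T phi0 nu00 lam k) (phi k).
  move=> kK; split; first exact: (gibbs_policyP phi0_policy gR kK).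
  move=> s u; apply: (flow_conditional (K := K)) => // j jK.
  exact: (gibbs_policyP phi0_policy gR jK).
exists (gibbs_flow K Y T phi0 nu00 lam), (gibbs_gamma K Y r T phi0 nu00 lam), phi.
split; [|split; [|split; [|split; [|split]]]].
- exact: gibbs_optimal.
- exact: optU.
- exact: condP.
- move=> nu' gamma' phi' opt' cond' k s u kK m0.
  have [nuE _] := optU _ _ opt' k kK.
  have [_ /(_ s u)] := cond' k kK; have [_ /(_ s u)] := condP k kK.
  have -> : state_marginal (nu' k) s
      = state_marginal (gibbs_flow K Y T phi0 nu00 lam k) s.
    by apply: eq_bigr => v _; rewrite nuE.
  rewrite nuE => -> /esym; apply: mulIf; first by rewrite gt_eqF.
- by exists lam, g; split=> //; exact: critical_multipliers.
(* At states of zero mass the optimum does not determine the policy; the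
   formula holds there because the multipliers are unique. *)
move=> lam' g' mult' gR' k s u kK.
have lamE : forall j, (1 <= j <= K)%N -> lam' j = lam j.
  exact: multipliers_unique mult'.
have gE := recursion_unique gR' lamE.
have k1K : (1 <= k <= K.+1)%N by case/andP: kK => -> /leqW.
have exponentE : exponent Y T lam' g' k s u = exponent Y T lam g k s u.
  rewrite /exponent (lamE _ kK).
  rewrite (eq_bigr (fun s' => T k (s, u) s' * g k.+1 s'))// => s' _.
  by rewrite (gE k.+1)//; case/andP: kK.
by rewrite exponentE (gE _ _ k1K).
Qed.
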